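(* Let $\mathrm{E}=\{E_i\}_{i=0}^{M-1}$ and $\mathrm{F}=\{F_j\}_{j=0}^{N-1}$ be two POVMs on a finite-dimensional complex Hilbert space $\mathcal{H}$. If $\mathrm{E}\succeq\mathrm{F}$, that is, if $\mathrm{F}$ is a coarse-graining of $\mathrm{E}$, then for every state $\rho$ on $\mathcal{H}$, $$C_{rel}(\rho,\mathrm{E})\ge C_{rel}(\rho,\mathrm{F}).$$
   Context: A state is a positive semidefinite operator of trace $1$. A POVM is a finite family of positive semidefinite operators summing to the identity. Measurement operators of a POVM $\mathrm{E}=\{E_i\}_i$ are operators $\{A_i\}_i$ with $E_i=A_i^\dagger A_i$. $H[\{p_i\}]=-\sum_i p_i\log p_i$ is the Shannon entropy and $S(\rho)=-\mathrm{Tr}(\rho\log\rho)$ the von Neumann entropy (with $0\log 0=0$). For a POVM $\mathrm{E}$ with measurement operators $\{A_i\}_i$, the outcome probabilities are $p_i(\rho)=\mathrm{Tr}(E_i\rho)$ and the outcome states are $\rho_i=\frac{1}{p_i(\rho)}A_i\rho A_i^\dagger$. The POVM-based coherence measure is $$C_{rel}(\rho,\mathrm{E})=H[\{p_i(\rho)\}]+\sum_i p_i(\rho)S(\rho_i)-S(\rho),$$ where terms with $p_i(\rho)=0$ are taken to be zero. Its value does not depend on the choice of measurement operators of $\mathrm{E}$. Coarse-graining: let $\mathrm{E}=\{E_i\}_{i=0}^{M-1}$ have measurement operators $\{A_i\}_{i=0}^{M-1}$. $\mathrm{F}=\{F_j\}_{j=0}^{N-1}$ is a coarse-graining of $\mathrm{E}$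 (written $\mathrm{E}\succeq\mathrm{F}$) if every outcome of $\mathrm{F}$ is a union of outcomes of $\mathrm{E}$: there are pairwise disjoint subsets $\Lambda_0,\dots,\Lambda_{N-1}$ with union $\{0,\dots,M-1\}$ such that, for every state $\rho$ and every $j$, the outcome probability is $$q_j(\rho)=\mathrm{Tr}(F_j\rho)=\sum_{i\in\Lambda_j}\mathrm{Tr}(E_i\rho)=\sum_{i\in\Lambda_j}p_i(\rho),$$ and the $j$-th outcome state of $\mathrm{F}$ is $$\rho_j^{\mathrm{F}}=\sum_{i\in\Lambda_j}\frac{p_i(\rho)}{q_j(\rho)}\,\rho_i,\qquad \rho_i=\frac{A_i\rho A_i^\dagger}{p_i(\rho)}.$$ For the coarse-graining $\mathrm{F}$, the measure is computed from these outcome probabilities and outcome states: $C_{rel}(\rho,\mathrm{F})=H[\{q_j(\rho)\}]+\sum_j q_j(\rho)S(\rho_j^{\mathrm{F}})-S(\rho)$, with terms with $q_j(\rho)=0$ taken to be zero. *)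

(* Defs.v *)
From HB Require Import structures.
From mathcomp Require Import all_boot all_order all_algebra.
From mathcomp Require Export complex.
From mathcomp Require Import reals exp.

Set Implicit Arguments.
Unset Strict Implicit.
Unset Printing Implicit Defensive.

Import Order.TTheory GRing.Theory Num.Theory.
Local Open Scope ring_scope.
Local Open Scope complex_scope.
Local Open Scope sesquilinear_scope.

(* Operators on an n-dimensional complex Hilbert space are matrices in
   'M[R[i]]_n (in an orthonormal basis); A ^t* is the adjoint of A. *)

(* 0 <= z in R[i] says that z is real and nonnegative, so hermiticity of A is
   part of this definition. *)
Definition psdmx (R : realType) n (A : 'M[R[i]]_n) : Prop :=
  forall v : 'cV[R[i]]_n, 0 <= (v ^t* *m A *m v) 0 0.

Definition qstate (R : realType) n (rho : 'M[R[i]]_n) : Prop :=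
  psdmx rho /\ \tr rho = 1.

Definition povm (R : realType) n M (E : 'I_M -> 'M[R[i]]_n) : Prop :=
  (forall i, psdmx (E i)) /\ \sum_i E i = 1%:M.

Definition measurement_operators (R : realType) n M
    (A E : 'I_M -> 'M[R[i]]_n) : Prop :=
  forall i, E i = (A i) ^t* *m A i.

Definition logb (R : realType) (b x : R) : R := ln x / ln b.

(* 0 log 0 = 0 holds because ln is a total function. *)
Definition shannon (R : realType) (b : R) M (p : 'I_M -> R) : R :=
  - \sum_i p i * logb b (p i).

(* Functional calculus f(A) of a Hermitian matrix A, from its unitary
   diagonalization A = P^-1 D P with P = spectralmx A. *)
Definition mxfun (R : realType) n (f : R -> R) (A : 'M[R[i]]_n) : 'M[R[i]]_n :=
  invmx (spectralmx A)
    *m diag_mx (map_mx (fun z => (f (complex.Re z))%:C) (spectral_diag A))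
    *m spectralmx A.

(* The trace is real when rho is Hermitian; the (finite) value that the total
   function ln takes at 0 is multiplied by the eigenvalue 0 of rho. *)
Definition von_neumann (R : realType) (b : R) n (rho : 'M[R[i]]_n) : R :=
  - complex.Re (\tr (rho *m mxfun (logb b) rho)).

(* Tr(E rho), which is real when E and rho are positive semidefinite. *)
Definition prob (R : realType) n (E rho : 'M[R[i]]_n) : R :=
  complex.Re (\tr (E *m rho)).

(* The i-th outcome state of the measurement with operators A; since 0^-1 = 0
   it is the zero matrix when the outcome has probability 0. *)
Definition outcome_state (R : realType) n M (A : 'I_M -> 'M[R[i]]_n)
    (i : 'I_M) (rho : 'M[R[i]]_n) : 'M[R[i]]_n :=
  ((prob ((A i) ^t* *m A i) rho)^-1)%:C *: (A i *m rho *m (A i) ^t*).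

(* Coherence of rho with respect to the POVM E whose i-th outcome state on
   input r is sE i r. Terms of probability 0 vanish whatever sE is there. *)
Definition Crel (R : realType) (b : R) n M (E : 'I_M -> 'M[R[i]]_n)
    (sE : 'I_M -> 'M[R[i]]_n -> 'M[R[i]]_n) (rho : 'M[R[i]]_n) : R :=
  shannon b (fun i => prob (E i) rho)
  + \sum_i prob (E i) rho * von_neumann b (sE i rho)
  - von_neumann b rho.

(* F, with outcome states sF, is a coarse-graining of E, with outcome states
   sE. The blocks L j may be empty; an outcome state of F is constrained only
   when the outcome has nonzero probability. *)
Definition coarse_graining (R : realType) n M N
    (E : 'I_M -> 'M[R[i]]_n) (sE : 'I_M -> 'M[R[i]]_n -> 'M[R[i]]_n)
    (F : 'I_N -> 'M[R[i]]_n) (sF : 'I_N -> 'M[R[i]]_n -> 'M[R[i]]_n) : Prop :=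
  exists L : 'I_N -> {set 'I_M},
    [/\ forall j k, j != k -> [disjoint L j & L k],
        \bigcup_j L j = [set: 'I_M] &
        forall rho, qstate rho -> forall j,
          prob (F j) rho = \sum_(i in L j) prob (E i) rho /\
          (prob (F j) rho != 0 ->
           sF j rho =
             \sum_(i in L j) (prob (E i) rho / prob (F j) rho)%:C *: sE i rho)].

(* Main.v *)
Require Import Defs.
From mathcomp Require Import all_boot all_order all_algebra.
From mathcomp Require Import reals exp.
From mathcomp Require Import ring lra.
Import Order.TTheory GRing.Theory Num.Theory.
Local Open Scope ring_scope.

(** Since [p_i S(rho_i) - p_i log p_i] is the entropy of the unnormalised state
    [A_i rho A_i^*], grouping reduces the claim, block by block, to the mixing
    bound [S(\sum p_i rho_i) <= H(p) + \sum p_i S(rho_i)].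

    Diagonalising every [rho_i] turns this into: if [X = \sum_a w_a u_a^* u_a]
    with unit vectors [u_a] and [mu] is the spectrum of [X], with unit
    eigenvectors [e_k], then [\sum w_a ln w_a <= \sum mu_k ln mu_k].  Put
    [c_ak = w_a |<e_k, u_a>|^2].  Then [\sum_k c_ak = w_a],
    [\sum_a c_ak = mu_k], and [\sum_k c_ak / mu_k <= 1] because
    [X >= w_a u_a^* u_a].  Hence [ln x >= 1 - 1 / x] gives
    [\sum_k c_ak (ln mu_k - ln w_a) >= w_a (1 - \sum_k c_ak / mu_k) >= 0],
    and it remains to sum over [a]. *)

Section Entropy.
Set Implicit Arguments.
Unset Strict Implicit.
Unset Printing Implicit Defensive.
Local Open Scope sesquilinear_scope.
Local Notation "x %:C" := (real_complex _ x).
Local Notation Re := (@complex.Re _).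
Implicit Types (R : realType).

(** * Real parts and squared moduli of complex numbers *)

Lemma Re_sum R (I : Type) (r : seq I) (P : pred I) (f : I -> R[i]) :
  Re (\sum_(i <- r | P i) f i) = \sum_(i <- r | P i) Re (f i).
Proof. by elim/big_rec2: _ => // i x y _ <-; case: (f i) => ? ?; case: y. Qed.

Lemma Re_realM R (a : R) (z : R[i]) : Re (a%:C * z) = a * Re z.
Proof. by case: z => u v /=; rewrite mul0r subr0. Qed.

Lemma ge0_realE R (z : R[i]) : 0 <= z -> z = (Re z)%:C.
Proof. by case: z => u v; rewrite lecE /= => /andP[/eqP-> _]. Qed.

Lemma Re_ge0 R (z : R[i]) : 0 <= z -> 0 <= Re z.
Proof. by case: z => u v; rewrite lecE /= => /andP[_ ]. Qed.

Definition normsq R (z : R[i]) : R := Re (z^* * z).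

Lemma normsqE R (z : R[i]) : (normsq z)%:C = z^* * z.
Proof.
by rewrite -ge0_realE // mulrC mul_conjC_ge0.
Qed.

Lemma normsq_ge0 R (z : R[i]) : 0 <= normsq z.
Proof. by rewrite Re_ge0 // mulrC mul_conjC_ge0. Qed.

(** This is [ln (1 + t) <= t] at [t = x^-1 - 1], negated. *)
Lemma ln_ge1BV R (x : R) : 0 < x -> 1 - x^-1 <= ln x.
Proof.
move=> x0; have xi0 : 0 < x^-1 by rewrite invr_gt0.
have : ln (1 + (x^-1 - 1)) <= x^-1 - 1 by apply: le_ln1Dx; lra.
by rewrite (_ : 1 + (x^-1 - 1) = x^-1); [rewrite lnV ?posrE //; lra | ring].
Qed.

(** * The scalar inequality behind the mixing bound, in eigenbasis coordinates *)

Section OverlapMatrix.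
Variables (R : realType) (n : nat) (I : finType) (P : pred I).
Variables (w : I -> R) (y : I -> 'I_n -> R[i]) (mu : 'I_n -> R).
Hypothesis w_ge0 : forall a, P a -> 0 <= w a.
Hypothesis y_unit : forall a, P a -> \sum_k normsq (y a k) = 1.
(** With [y a k] the coordinate of u_a along e_k, this is the identity X = \sum_a w_a u_a^* u_a
    written in the eigenbasis of X, where X is [diag mu]. *)
Hypothesis gram : forall k l,
  \sum_(a | P a) (w a)%:C * ((y a k)^* * y a l) = (mu k)%:C *+ (k == l).

Lemma sum_overlap k : \sum_(a | P a) w a * normsq (y a k) = mu k.
Proof.
apply: (@complexI R); have := gram k k; rewrite eqxx mulr1n => <-.
by rewrite rmorph_sum; apply: eq_bigr => a _; rewrite rmorphM /= normsqE.
Qed.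

Lemma mu_ge0 k : 0 <= mu k.
Proof.
rewrite -sum_overlap; apply: sumr_ge0 => a Pa.
by rewrite mulr_ge0 ?normsq_ge0 ?w_ge0.
Qed.

(** Both sides are the quadratic form of X at [z]: once the square is expanded, [gram] kills the
    terms with [k != l]. *)
Lemma gram_form (z : 'I_n -> R[i]) :
  \sum_(a | P a) w a * normsq (\sum_k y a k * z k)
  = \sum_k mu k * normsq (z k).
Proof.
apply: (@complexI R); rewrite !rmorph_sum.
transitivity (\sum_(a | P a) \sum_k \sum_l
   (z k)^* * z l * ((w a)%:C * ((y a k)^* * y a l))).
  apply: eq_bigr => a _; rewrite rmorphM /= normsqE rmorph_sum /=.
  rewrite mulr_suml mulr_sumr; apply: eq_bigr => k _.
  rewrite mulr_sumr mulr_sumr; apply: eq_bigr => l _; rewrite rmorphM /=.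
  by ring.
rewrite exchange_big; apply: eq_bigr => k _ /=.
rewrite exchange_big /= (bigD1 k) //= -mulr_sumr gram eqxx mulr1n.
rewrite big1 ?addr0 => [|l lk]; last first.
  by rewrite -mulr_sumr gram eq_sym (negPf lk) mulr0n mulr0.
by rewrite [in RHS]rmorphM /= normsqE mulrC.
Qed.

(* The quadratic form of [diag mu - w a * y_a^* y_a >= 0], evaluated at the
   vector [diag mu ^-1 y_a^*]. *)
Lemma overlap_le1 a : P a -> w a * \sum_k normsq (y a k) / mu k <= 1.
Proof.
move=> Pa; set s := \sum_k _.
have s_ge0 : 0 <= s.
  by apply: sumr_ge0 => k _; rewrite divr_ge0 ?normsq_ge0 ?mu_ge0.
pose z k := (y a k)^* * ((mu k)^-1)%:C.
have zE : \sum_k y a k * z k = s%:C.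
  rewrite rmorph_sum; apply: eq_bigr => k _.
  by rewrite rmorphM /= normsqE /z; ring.
have normzE : \sum_k mu k * normsq (z k) = s.
  apply: eq_bigr => k _; rewrite /z.
  have -> : normsq ((y a k)^* * ((mu k)^-1)%:C) = normsq (y a k) * (mu k)^-1 ^+ 2.
    apply: (@complexI R); rewrite rmorphM rmorphXn /= !normsqE rmorphM /=.
    rewrite conjCK (_ : ((mu k)^-1)%:C^* = ((mu k)^-1)%:C); first by ring.
    exact: conjc_real.
  have [->|mu0] := eqVneq (mu k) 0; first by rewrite invr0 !mulr0 mul0r.
  by field.
(* Only the term [a] of [gram_form] is kept, the others being nonnegative. Dividing by [s] then
   gives the claim when [s] is nonzero. *)
have : w a * s ^+ 2 <= s.
  rewrite -{2}normzE -gram_form (bigD1 a) //= zE.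
  have -> : normsq s%:C = s ^+ 2.
    by rewrite /normsq -[_^*]/(conjc _) conjc_real /= expr2; ring.
  rewrite lerDl; apply: sumr_ge0 => c /andP[Pc _].
  by rewrite mulr_ge0 ?normsq_ge0 ?w_ge0.
have [->|s0] := eqVneq s 0; first by rewrite mulr0 ler01.
rewrite expr2 mulrA -{3}[s]mul1r ler_pM2r //.
by rewrite lt_def s0.
Qed.

Lemma sum_xlnx_le :
  \sum_(a | P a) w a * ln (w a) <= \sum_k mu k * ln (mu k).
Proof.
have -> : \sum_k mu k * ln (mu k) =
    \sum_(a | P a) \sum_k w a * normsq (y a k) * ln (mu k).
  rewrite exchange_big; apply: eq_bigr => k _ /=.
  by rewrite -mulr_suml sum_overlap.
apply: ler_sum => a Pa.
have [->|wn0] := eqVneq (w a) 0.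
  by rewrite mul0r big1 // => k _; rewrite !mul0r.
have w0 : 0 < w a by rewrite lt_def wn0 w_ge0.
(* The added slack is nonnegative by [overlap_le1]. By [y_unit] it can be spread over [k], which
   leaves one inequality for each pair [(a, k)]. *)
apply: (@le_trans _ _ (w a * ln (w a)
    + w a * (1 - w a * \sum_k normsq (y a k) / mu k))).
  by rewrite lerDl mulr_ge0 ?w_ge0 // subr_ge0 overlap_le1.
have -> : w a * ln (w a) + w a * (1 - w a * \sum_k normsq (y a k) / mu k)
    = w a * \sum_k normsq (y a k) * (ln (w a) + 1 - w a / mu k).
  rewrite [in RHS](eq_bigr (fun k => normsq (y a k) * (ln (w a) + 1)
     - w a * (normsq (y a k) / mu k))); last by move=> k _; ring.
  by rewrite sumrB -mulr_suml -mulr_sumr y_unit //; ring.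
rewrite mulr_sumr; apply: ler_sum => k _; rewrite -mulrA ler_wpM2l ?w_ge0 //.
(* Zero overlaps are split off first: when [mu k = 0] the logarithmic bound may fail, but then the
   overlap vanishes because [w a > 0]. *)
have [c0|cn0] := eqVneq (normsq (y a k)) 0; first by rewrite c0 !mul0r.
rewrite ler_wpM2l ?normsq_ge0 //.
have mu0 : 0 < mu k.
  apply: (@lt_le_trans _ _ (w a * normsq (y a k))).
    by rewrite mulr_gt0 // lt_def cn0 normsq_ge0.
  rewrite -sum_overlap (bigD1 a) //= lerDl.
  by apply: sumr_ge0 => c /andP[Pc _]; rewrite mulr_ge0 ?normsq_ge0 ?w_ge0.
have := @ln_ge1BV _ (mu k / w a) (divr_gt0 mu0 w0).
by rewrite ln_div ?posrE // invf_div; lra.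
Qed.

End OverlapMatrix.

(** * Hermiticity and spectral decomposition of positive semidefinite matrices *)

Lemma psdmx_adjointK R n (A : 'M[R[i]]_n) : psdmx A -> A ^t* = A.
Proof.
move=> Apsd; apply/matrixP => l k; rewrite !mxE.
pose B (u v : 'cV[R[i]]_n) := (u ^t* *m A *m v) 0 0.
have ImB v : complex.Im (B v v) = 0 by apply: ger0_Im; exact: Apsd.
have BDl u u' v : B (u + u') v = B u v + B u' v.
  by rewrite /B linearD /= map_mxD !mulmxDl mxE.
have BDr u v v' : B u (v + v') = B u v + B u v'.
  by rewrite /B !mulmxDr mxE.
have BZl c u v : B (c *: u) v = c^* * B u v.
  by rewrite /B linearZ /= map_mxZ -!scalemxAl mxE.
have BZr c u v : B u (c *: v) = c * B u v.
  by rewrite /B -!scalemxAr mxE.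
pose e j : 'cV[R[i]]_n := delta_mx j 0.
have AE j m : A j m = B (e j) (e m).
  by rewrite /B /e trmx_delta map_delta_mx -rowE -colE !mxE.
(* Polarisation: reality of the form at e_k + e_l relates the imaginary parts of [A k l] and
   [A l k], and at e_k + i e_l their real parts. *)
have := ImB (e k + e l); have := ImB (e k + (0 +i* 1)%C *: e l).
rewrite !BDl !BDr !BZl !BZr -!AE.
have := ImB (e k); have := ImB (e l); rewrite -!AE.
rewrite -[(A k l)^*]/(conjc _) -[(_ +i* _)%C^*]/(conjc _).
case: (A k k) => kk1 kk2; case: (A k l) => kl1 kl2; case: (A l k) => lk1 lk2.
case: (A l l) => ll1 ll2 /= h1 h2 h3 h4.
by congr (_ +i* _)%C; lra.
Qed.

Lemma psdmx_normal R n (A : 'M[R[i]]_n) : psdmx A -> A \is normalmx.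
Proof. by move=> /psdmx_adjointK AK; apply/normalmxP; rewrite AK. Qed.

Definition eigval R n (A : 'M[R[i]]_n) (k : 'I_n) : R :=
  Re (spectral_diag A 0 k).

(** Since A = U^* D U with U = [spectralmx A], the column eigenvectors of A are the adjoints of
    these rows. *)
Definition eigvec R n (A : 'M[R[i]]_n) (k : 'I_n) : 'rV[R[i]]_n :=
  row k (spectralmx A).

Lemma spectralmxK R n (A : 'M[R[i]]_n) :
  spectralmx A *m (spectralmx A) ^t* = 1%:M.
Proof. exact/unitarymxP/spectral_unitarymx. Qed.

Lemma invmx_spectralmx R n (A : 'M[R[i]]_n) :
  invmx (spectralmx A) = (spectralmx A) ^t*.
Proof. exact/invmx_unitary/spectral_unitarymx. Qed.

Lemma eigvec_unit R n (A : 'M[R[i]]_n) k :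
  eigvec A k *m (eigvec A k) ^t* = 1%:M.
Proof.
rewrite /eigvec rowE trmx_mul map_mxM -mulmxA.
rewrite [spectralmx A *m _]mulmxA spectralmxK mul1mx trmx_delta map_delta_mx mul_delta_mx.
by apply/matrixP => i j; rewrite !mxE !ord1.
Qed.

Section Spectral.
Variables (R : realType) (n : nat) (A : 'M[R[i]]_n).
Hypothesis Apsd : psdmx A.
Local Notation U := (spectralmx A).

Lemma spectral_conj : U *m A *m U ^t* = diag_mx (spectral_diag A).
Proof.
have /orthomx_spectralP AE := psdmx_normal Apsd.
rewrite {2}AE invmx_spectralmx !mulmxA spectralmxK mul1mx.
by rewrite -mulmxA spectralmxK mulmx1.
Qed.

Lemma spectral_diag_ge0 k : 0 <= spectral_diag A 0 k.
Proof.
have := Apsd ((eigvec A k) ^t*).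
rewrite /eigvec rowE trmxCK.
rewrite trmx_mul map_mxM !mulmxA -[_ *m U *m A]mulmxA -[_ *m (U *m A) *m _]mulmxA.
rewrite spectral_conj trmx_delta map_delta_mx -rowE -colE !mxE eqxx mulr1n.
by [].
Qed.

Lemma eigvalE k : (eigval A k)%:C = spectral_diag A 0 k.
Proof. by rewrite /eigval -ge0_realE // spectral_diag_ge0. Qed.

Lemma eigval_ge0 k : 0 <= eigval A k.
Proof. exact/Re_ge0/spectral_diag_ge0. Qed.

Lemma spectral_decomposition :
  A = \sum_k (eigval A k)%:C *: ((eigvec A k) ^t* *m eigvec A k).
Proof.
have /orthomx_spectralP {1}-> := psdmx_normal Apsd.
rewrite invmx_spectralmx; apply/matrixP => r c; rewrite summxE mxE.
apply: eq_bigr => k _; rewrite mul_mx_diag !mxE big_ord1 !mxE -eigvalE.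
by ring.
Qed.

Lemma mxtrace_eigval : Re (\tr A) = \sum_k eigval A k.
Proof.
rewrite {1}spectral_decomposition [\tr _]raddf_sum Re_sum; apply: eq_bigr => k _ /=.
by rewrite linearZ /= mxtrace_mulC eigvec_unit mxtrace1 Re_realM /= mulr1.
Qed.

(** [A] and [mxfun (logb b) A] are diagonal in the same basis, so by cyclicity the trace is that of
    a product of diagonal matrices. *)
Lemma von_neumann_eigval b :
  von_neumann b A = - \sum_k eigval A k * logb b (eigval A k).
Proof.
rewrite /von_neumann /mxfun.
have /orthomx_spectralP {1}-> := psdmx_normal Apsd.
rewrite mulmxA mulmxA mulmxK ?spectral_unit // mxtrace_mulC !mulmxA.
rewrite mulmxV ?spectral_unit // mul1mx mulmx_diag mxtrace_diag Re_sum.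
congr (- _); apply: eq_bigr => k _.
by rewrite !mxE -eigvalE Re_realM.
Qed.

(* In the eigenbasis of [A] the decomposition becomes the hypothesis [gram] of
   [sum_xlnx_le]. *)
Lemma sum_xlnx_le_eigval (I : finType) (P : pred I) (w : I -> R)
    (u : I -> 'rV[R[i]]_n) :
    (forall a, P a -> 0 <= w a) ->
    (forall a, P a -> u a *m (u a) ^t* = 1%:M) ->
    A = \sum_(a | P a) (w a)%:C *: ((u a) ^t* *m u a) ->
  \sum_(a | P a) w a * ln (w a) <= \sum_k eigval A k * ln (eigval A k).
Proof.
move=> w_ge0 u_unit AE.
pose y a (k : 'I_n) := (u a *m U ^t*) 0 k.
apply: (@sum_xlnx_le _ _ _ _ _ y) => // [a Pa|k l].
  have yy1 : (u a *m U ^t*) *m (u a *m U ^t*) ^t* = 1%:M.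
    rewrite trmx_mul map_mxM trmxCK mulmxA -[_ *m U ^t* *m U]mulmxA.
    by rewrite (mulmx1C (spectralmxK A)) mulmx1 u_unit.
  apply: (@complexI R); rewrite rmorph_sum.
  have := congr1 (fun B : 'M_1 => B 0 0) yy1.
  rewrite mxE [in X in _ = X -> _]mxE eqxx => yE; apply/esym; rewrite [LHS]rmorph1.
  apply: etrans (esym yE) _.
  by apply: eq_bigr => k _ /=; rewrite normsqE /y !mxE mulrC.
have := congr1 (fun M : 'M_n => M k l) spectral_conj.
rewrite {2}AE mulmx_sumr mulmx_suml summxE.
rewrite [in X in _ = X -> _]mxE -eigvalE => <-; apply: eq_bigr => a _.
rewrite -scalemxAr -scalemxAl mulmxA -[_ *m u a *m _]mulmxA [RHS]mxE; congr (_ * _).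
rewrite [RHS]mxE big_ord1 /y; congr (_ * _).
rewrite !mxE rmorph_sum; apply: eq_bigr => m _ /=.
by rewrite !mxE rmorphM /= conjCK mulrC.
Qed.

End Spectral.

(** * Stability of positivity and the mixing bound for the entropy *)

Lemma psdmxZ R n (c : R) (A : 'M[R[i]]_n) :
  0 <= c -> psdmx A -> psdmx (c%:C *: A).
Proof.
by move=> c0 Apsd v; rewrite -scalemxAr -scalemxAl mxE mulr_ge0 ?lecR ?Apsd.
Qed.

Lemma psdmx_sum R n (I : Type) (r : seq I) (P : pred I) (A : I -> 'M[R[i]]_n) :
  (forall i, P i -> psdmx (A i)) -> psdmx (\sum_(i <- r | P i) A i).
Proof.
move=> Apsd v; rewrite mulmx_sumr mulmx_suml summxE.
by apply: sumr_ge0 => i Pi; exact: Apsd.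
Qed.

Lemma psdmx_conj R m n (B : 'M[R[i]]_(m, n)) (A : 'M[R[i]]_n) :
  psdmx A -> psdmx (B *m A *m B ^t*).
Proof.
move=> Apsd v; have := Apsd (B ^t* *m v).
by rewrite trmx_mul map_mxM trmxCK !mulmxA.
Qed.

Lemma mxtrace_psd_ge0 R n (A : 'M[R[i]]_n) : psdmx A -> 0 <= \tr A.
Proof.
move=> Apsd; apply: sumr_ge0 => k _; have := Apsd (delta_mx k 0).
by rewrite trmx_delta map_delta_mx -rowE -colE !mxE.
Qed.

Lemma xlnxM R (x y : R) : 0 <= x -> 0 <= y ->
  x * y * ln (x * y) = x * ln x * y + x * (y * ln y).
Proof.
move=> x0 y0; have [->|xn0] := eqVneq x 0; first by rewrite !mul0r addr0.
have [->|yn0] := eqVneq y 0; first by rewrite !(mulr0, mul0r) addr0.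
by rewrite lnM ?posrE ?lt_def ?xn0 ?yn0 //; ring.
Qed.

(** Trace one is asked only where [p i != 0], because [outcome_state] is the zero matrix at an
    outcome of probability 0. *)
Lemma von_neumann_mix R (b : R) (hb : 1 < b) n (I : finType) (P : pred I)
    (p : I -> R) (r : I -> 'M[R[i]]_n) :
    (forall i, P i -> 0 <= p i) -> (forall i, P i -> psdmx (r i)) ->
    (forall i, P i -> p i != 0 -> \tr (r i) = 1) ->
  von_neumann b (\sum_(i | P i) (p i)%:C *: r i)
    <= - \sum_(i | P i) p i * logb b (p i)
       + \sum_(i | P i) p i * von_neumann b (r i).
Proof.
move=> p_ge0 r_psd r_tr; set X := \sum_(i | P i) _.
have Xpsd : psdmx X.
  by apply: psdmx_sum => i Pi; apply: psdmxZ; [exact: p_ge0 | exact: r_psd].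
have lnb_gt0 : 0 < ln b by exact: ln_gt0.
rewrite von_neumann_eigval // -sumrN -sumrN -big_split /=.
rewrite -(ler_pM2r lnb_gt0) !mulr_suml.
rewrite [leLHS](eq_bigr (fun k => - (eigval X k * ln (eigval X k)))); last first.
  by move=> k _; rewrite /logb; field; rewrite gt_eqF.
(* The rank-one terms are indexed by pairs: a component [i] of the mixture and an eigenvector of
   [r i]. *)
pose w (a : I * 'I_n) := p a.1 * eigval (r a.1) a.2.
pose u (a : I * 'I_n) := eigvec (r a.1) a.2.
have le_ln : \sum_(a | P a.1 && true) w a * ln (w a)
    <= \sum_k eigval X k * ln (eigval X k).
  apply: (@sum_xlnx_le_eigval _ _ _ Xpsd _ _ _ u) => [a|a _|].
  - by rewrite andbT => Pa; rewrite mulr_ge0 ?p_ge0 ?eigval_ge0 //; exact: r_psd.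
  - exact: eigvec_unit.
  - rewrite -(pair_big P predT (fun i k => (w (i, k))%:C *:
       ((u (i, k)) ^t* *m u (i, k)))) /=.
    apply: eq_bigr => i Pi; rewrite {1}(spectral_decomposition (r_psd i Pi)).
    rewrite scaler_sumr; apply: eq_bigr => k _.
    by rewrite /w rmorphM /= scalerA.
rewrite sumrN lerNl -sumrN; apply: le_trans le_ln.
rewrite -(pair_big P predT (fun i k => w (i, k) * ln (w (i, k)))) /=.
apply: ler_sum => i Pi; rewrite von_neumann_eigval; last exact: r_psd.
(* Each [i] gives an equality: [xlnxM] splits the logarithm of [w], and the eigenvalues of [r i] sum
   to its trace, which is 1 unless [p i = 0]. *)
rewrite le_eqVlt; apply/orP; left; apply/eqP.
rewrite [RHS](eq_bigr (fun k => p i * ln (p i) * eigval (r i) k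
   + p i * (eigval (r i) k * ln (eigval (r i) k)))); last first.
  by move=> k _; rewrite /w /= xlnxM ?p_ge0 ?eigval_ge0 //; exact: r_psd.
rewrite big_split /= -!mulr_sumr -mxtrace_eigval; last exact: r_psd.
rewrite [\sum_k eigval (r i) k * logb _ _](eq_bigr (fun k =>
   eigval (r i) k * ln (eigval (r i) k) / ln b)); last first.
  by move=> k _; rewrite /logb mulrA.
rewrite -mulr_suml /logb.
have [->|pn0] := eqVneq (p i) 0; first by rewrite !mul0r; ring.
by rewrite r_tr //=; field; rewrite gt_eqF.
Qed.

(** Chain rule of the entropy: log (p_i / q) = log p_i - log q, and the weights p_i sum to q. *)
Lemma shannon_grouping R (b : R) (I : finType) (P : pred I) (p : I -> R) q :
    (forall i, P i -> 0 <= p i) -> \sum_(i | P i) p i = q -> 0 < q ->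
  q * (\sum_(i | P i) p i / q * logb b (p i / q))
    = \sum_(i | P i) p i * logb b (p i) - q * logb b q.
Proof.
move=> p_ge0 pq q0; rewrite -{4}pq mulr_suml -sumrB mulr_sumr.
apply: eq_bigr => i Pi.
have [->|pn0] := eqVneq (p i) 0; first by rewrite !mul0r mulr0 subr0.
have p_gt0 : 0 < p i by rewrite lt_def pn0 p_ge0.
rewrite /logb ln_div ?posrE //.
by rewrite !mulrBl; move: (ln b)^-1 => c; field; rewrite gt_eqF.
Qed.

(** * Positivity and normalisation of outcome states *)

Section OutcomeState.
Variables (R : realType) (n M : nat) (A : 'I_M -> 'M[R[i]]_n) (i : 'I_M).
Variable (rho : 'M[R[i]]_n).
Hypothesis rho_psd : psdmx rho.
Local Notation p := (prob ((A i) ^t* *m A i) rho).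

Lemma prob_outcomeE : p%:C = \tr (A i *m rho *m (A i) ^t*).
Proof.
rewrite /prob [\tr (_ *m _ *m (A i) ^t*)]mxtrace_mulC mulmxA -ge0_realE //.
rewrite -mulmxA mxtrace_mulC; exact/mxtrace_psd_ge0/psdmx_conj.
Qed.

Lemma prob_outcome_ge0 : 0 <= p.
Proof. by rewrite -lecR prob_outcomeE; exact/mxtrace_psd_ge0/psdmx_conj. Qed.

Lemma psdmx_outcome : psdmx (outcome_state A i rho).
Proof. by apply/psdmxZ/psdmx_conj => //; rewrite invr_ge0 prob_outcome_ge0. Qed.

Lemma mxtrace_outcome : p != 0 -> \tr (outcome_state A i rho) = 1.
Proof.
move=> pn0; rewrite /outcome_state mxtraceZ -prob_outcomeE.
by rewrite -rmorphM mulVf // rmorph1.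
Qed.

End OutcomeState.
End Entropy.

Theorem mainTheorem2 (R : realType) (b : R) (hb : 1 < b) (n M N : nat)
    (E A : 'I_M -> 'M[R[i]]_n) (F : 'I_N -> 'M[R[i]]_n)
    (sF : 'I_N -> 'M[R[i]]_n -> 'M[R[i]]_n)
    (hE : povm E) (hF : povm F) (hA : measurement_operators A E)
    (hEF : coarse_graining E (outcome_state A) F sF)
    (rho : 'M[R[i]]_n) (hrho : qstate rho) :
  Crel b E (outcome_state A) rho >= Crel b F sF rho.
Proof.
case: hEF => L [Ldisj Lcover LF].
have rho_psd := hrho.1.
pose p i := prob (E i) rho; pose q j := prob (F j) rho.
have p_ge0 i : 0 <= p i by rewrite /p hA; exact: prob_outcome_ge0.
have qE j : q j = \sum_(i in L j) p i by have [] := LF rho hrho j.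
have q_ge0 j : 0 <= q j by rewrite qE sumr_ge0.
rewrite /Crel lerD2r /shannon -!sumrN -!big_split /=.
have sum_blocks (f : 'I_M -> R) : \sum_i f i = \sum_j \sum_(i in L j) f i.
  rewrite -partition_disjoint_bigcup // Lcover.
  by apply: eq_bigl => i; rewrite inE.
(* With S(rho) cancelled and the outcomes of [E] grouped by the partition [L], one block at a time
   suffices. *)
rewrite [leRHS]sum_blocks; apply: ler_sum => j _; rewrite -/(q j).
have [q0|qn0] := eqVneq (q j) 0.
  (* A null block consists of null outcomes, as a zero sum of nonnegative terms, so both sides
     vanish. *)
  rewrite q0 !mul0r oppr0 addr0 big1 // => i iL.
  have /eqP : \sum_(i in L j) p i = 0 by rewrite -qE.
  rewrite psumr_eq0 // => /allP /(_ i); rewrite mem_index_enum iL => /(_ isT).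
  by rewrite /p => /eqP ->; rewrite !mul0r oppr0 addr0.
have q_gt0 : 0 < q j by rewrite lt_def qn0 q_ge0.
have [_ /(_ qn0) ->] := LF rho hrho j.
have le_mix : von_neumann b (\sum_(i in L j)
    real_complex _ (p i / q j) *: outcome_state A i rho)
  <= - \sum_(i in L j) p i / q j * logb b (p i / q j)
     + \sum_(i in L j) p i / q j * von_neumann b (outcome_state A i rho).
  apply: von_neumann_mix => // [i _|i _|i _ pn0].
  - by rewrite divr_ge0.
  - exact: psdmx_outcome.
  - apply: mxtrace_outcome => //; rewrite -hA.
    by apply: contra_neq pn0 => p0; rewrite /p p0 mul0r.
apply: le_trans (lerD (lexx _) (ler_wpM2l (q_ge0 j) le_mix)) _.
(* Weighted by [q j], the entropy of the conditional distribution produces a term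
   [q j * logb b (q j)] that cancels the Shannon term of [F]. *)
rewrite mulrDr mulrN shannon_grouping // ?qE // -?qE //.
rewrite big_split /= sumrN mulr_sumr.
rewrite [\sum_(i in L j) q j * _](eq_bigr (fun i =>
  p i * von_neumann b (outcome_state A i rho))); last first.
  by move=> i _; field.
lra.
Qed.
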